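(* For every integer $n\ge 1$, the double $3$-threshold sequences of length $n$ are in bijection with the ordered pairs of ternary trees whose total number of internal nodes is $n$.
   Context: A double $3$-threshold sequence of length $n$ is a strictly increasing sequence $(s_1s_2\ldots s_n)$ of integers such that $3i\le s_i\le 3n+1$ for all $1\le i\le n$. A ternary tree is a rooted tree in which every internal node has exactly three children, ordered from left to right; it is either trivial (a unique node, which is not internal) or consists of an internal root node and three ordered ternary subtrees. Two ternary trees are equal iff both are trivial, or both are non-trivial with the same subtrees in the same order. *)

(* Defs.v *)
From mathcomp Require Import all_boot all_order all_algebra.

Set Implicit Arguments.
Unset Strict Implicit.
Unset Printing Implicit Defensive.

Import Order.TTheory GRing.Theory Num.Theory.

(* Positions are 0-based here: the term s_(i+1) is [tnth s i]. *)
Definition double_3_threshold (n : nat) (s : n.-tuple int) : bool :=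
  sorted (<%R)%R s &&
  [forall i : 'I_n, ((3 * i.+1)%N%:Z <= tnth s i <= (3 * n + 1)%N%:Z)%R].

Inductive ternary_tree : Type :=
| TLeaf
| TNode of ternary_tree & ternary_tree & ternary_tree.

Fixpoint internal_nodes (t : ternary_tree) : nat :=
  if t is TNode l m r then
    (internal_nodes l + internal_nodes m + internal_nodes r).+1
  else 0.

(* Main.v *)
Require Import Defs.
From mathcomp Require Import all_boot all_order all_algebra.
From mathcomp Require Import zify.

(** Mark the terms of a sequence [s] among the positions 1, ..., 3n+1 and read
    an unmarked position as "push a leaf" and a marked one as "replace the top
    three trees of the stack by their parent".  Starting from a stack holding one
    leaf, the condition [3i <= s_i] says exactly that the stack never underflows,
    and the number of marks being n says that two trees remain at the end.  Hence
    a leaf followed by the word of [s] is the concatenation of the postfix codes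
    of two ternary trees, and it determines them. *)

Set Implicit Arguments.
Unset Strict Implicit.
Unset Printing Implicit Defensive.

Import Order.TTheory GRing.Theory Num.Theory.

Fixpoint postfix (t : ternary_tree) : seq bool :=
  if t is TNode l m r then postfix l ++ postfix m ++ postfix r ++ [:: true]
  else [:: false].

(* The stack height [d] suffices for running the word, and ends at 2. *)
Fixpoint runnable (d : nat) (w : seq bool) : bool :=
  match w with
  | [::] => d == 2
  | true :: w' => (2 < d) && runnable (d - 2) w'
  | false :: w' => runnable d.+1 w'
  end.

(** The head of the list is the top of the stack, so the right child is popped first. On underflow
    the stack is returned unchanged, a junk value that [runnable] excludes. *)
Definition step (st : seq ternary_tree) (b : bool) : seq ternary_tree :=
  if b then (if st is [:: r, m, l & st'] then TNode l m r :: st' else st)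
  else TLeaf :: st.

Definition stack_word (st : seq ternary_tree) : seq bool :=
  flatten (map postfix (rev st)).

Lemma stack_word_cons t st :
  stack_word (t :: st) = stack_word st ++ postfix t.
Proof. by rewrite /stack_word rev_cons map_rcons flatten_rcons. Qed.

Lemma foldl_step_postfix t st : foldl step st (postfix t) = t :: st.
Proof.
elim: t st => [|l IHl m IHm r IHr] st //=.
by rewrite !foldl_cat IHl IHm IHr.
Qed.

Lemma runnable_postfix t d w : runnable d (postfix t ++ w) = runnable d.+1 w.
Proof.
elim: t d w => [|l IHl m IHm r IHr] d w //=.
by rewrite -!catA IHl IHm IHr /= subn2.
Qed.

(** The codes of the stacked trees, from bottom to top, followed by the unread letters form a word
    that no step changes. *)
Lemma runnable_foldl_step w st : runnable (size st) w ->
  size (foldl step st w) = 2 /\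
  stack_word (foldl step st w) = stack_word st ++ w.
Proof.
elim: w st => [|[] w IHw] st /=; first by move/eqP; rewrite cats0.
  case: st => [|r [|m [|l st]]] //=; rewrite subn2.
  move=> /(IHw (TNode l m r :: st)) [-> ->].
  by rewrite !stack_word_cons /= -!catA.
by move=> /(IHw (TLeaf :: st)) [-> ->]; rewrite stack_word_cons -catA.
Qed.

(** The initial [TLeaf] accounts for the first letter dropped by [unparse]. The default pair is
    never reached from a word that is runnable at height 1. *)
Definition parse (w : seq bool) : ternary_tree * ternary_tree :=
  if foldl step [:: TLeaf] w is [:: r; l] then (l, r) else (TLeaf, TLeaf).

(* Every postfix code starts with a leaf, which is the one dropped here. *)
Definition unparse (p : ternary_tree * ternary_tree) : seq bool :=
  behead (postfix p.1 ++ postfix p.2).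

Lemma postfix_behead t : postfix t = false :: behead (postfix t).
Proof.
by elim: t => [|l IHl m _ r _] //=; rewrite {1}IHl /= {2}IHl.
Qed.

Lemma unparseE p : false :: unparse p = postfix p.1 ++ postfix p.2.
Proof. by rewrite /unparse postfix_behead. Qed.

Lemma unparseK : cancel unparse parse.
Proof.
(* By conversion, the initial stack is the result of reading [false] on the empty stack, which
   restores the two complete codes. *)
move=> p; rewrite /parse -[foldl _ _ _]/(foldl step [::] (false :: unparse p)).
by rewrite unparseE foldl_cat !foldl_step_postfix; case: p.
Qed.

Lemma parseK w : runnable 1 w -> unparse (parse w) = w.
Proof.
move=> /(runnable_foldl_step (st := [:: TLeaf])) []; rewrite /parse.
case: (foldl _ _ _) => [|r [|l [|]]] //= _.
by rewrite !stack_word_cons /unparse /= => ->.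
Qed.

Lemma runnable_unparse p : runnable 1 (unparse p).
Proof.
rewrite -[runnable _ _]/(runnable 0 (false :: unparse p)) unparseE.
(* The empty suffix puts both codes in the form of [runnable_postfix]; each raises the height by
   one, from 0 to the required 2. *)
by rewrite -[_ ++ _]cats0 -catA !runnable_postfix.
Qed.

Lemma count_postfix t :
  count id (postfix t) = internal_nodes t /\
  count negb (postfix t) = (2 * internal_nodes t).+1.
Proof.
elim: t => [|l [l1 l2] m [m1 m2] r [r1 r2]] //=.
by rewrite !count_cat l1 l2 m1 m2 r1 r2 /=; split; lia.
Qed.

Lemma count_unparse p :
  count id (unparse p) = internal_nodes p.1 + internal_nodes p.2 /\
  count negb (unparse p) = (2 * (internal_nodes p.1 + internal_nodes p.2)).+1.
Proof.
have [l1 l2] := count_postfix p.1; have [r1 r2] := count_postfix p.2.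
have := congr1 (count id) (unparseE p); have := congr1 (count negb) (unparseE p).
by rewrite !count_cat l1 l2 r1 r2 /= => h1 h2; split; lia.
Qed.

Definition grid (o N : nat) : seq int := map Posz (iota o N).

Lemma size_grid o N : size (grid o N) = N.
Proof. by rewrite size_map size_iota. Qed.

Lemma sorted_grid o N : sorted (<%R)%R (grid o N).
Proof.
by rewrite sorted_map (sub_sorted _ (iota_ltn_sorted o N)) // => i j; rewrite /= ltz_nat.
Qed.

Lemma mem_grid o N (x : int) :
  (x \in grid o N) = ((o%:Z <= x)%R && (x < (o + N)%N%:Z)%R).
Proof.
apply/mapP/idP => [[i]|]; first by rewrite mem_iota => + ->; lia.
by case: x => // i ?; exists i => //; rewrite mem_iota; lia.
Qed.

Lemma uniq_grid o N : uniq (grid o N).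
Proof. by rewrite map_inj_uniq ?iota_uniq // => i j []. Qed.

(* The stack height before reading position [o], when the next mark to come is
   the [k]-th one, is [d = o + 3 - 3 * k]. *)
Lemma runnable_maskP d k o w : d + 3 * k = o + 3 ->
  let s := mask w (grid o (size w)) in
  runnable d w <->
  (forall i, i < size s -> ((3 * (k + i))%N%:Z <= nth 0%R s i)%R) /\
  d + count negb w = 2 + 2 * count id w.
Proof.
elim: w d k o => [|[] w IHw] d k o dko /=.
- by split=> [/eqP ->|[_ h]]; [split | lia].
- case: (ltnP 2 d) => [d_gt2|d_le2] /=; last first.
    (* With [d = o + 3 - 3 * k], a height of at most 2 means [o < 3 * k], so the mark at [o]
       violates its own bound. *)
    by split=> // -[/(_ 0 isT) /=]; lia.
  have [|r1 r2] := IHw (d - 2) k.+1 o.+1; first lia.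
  rewrite -/(grid _ _); split=> [/r1 [h1 h2]|[h1 h2]].
    split=> [[|i] ilt|].
    + by rewrite addn0 /=; lia.
    + by have := h1 i ilt; rewrite addSnnS.
    + by lia.
  by apply: r2; split=> [i ilt|]; [rewrite addSnnS; exact: (h1 i.+1) | lia].
(* An unmarked position contributes no term, so [k] stays while [d] and [o] both grow by one. *)
have [|r1 r2] := IHw d.+1 k o.+1; first lia.
rewrite -/(grid _ _); split=> [/r1 [h1 h2]|[h1 h2]]; first by split; [|lia].
by apply: r2; split; [|lia].
Qed.

(** The upper bound becomes membership in the grid, whose lower end 1 follows from the threshold;
    the lower bounds take the shape of [runnable_maskP] at [k = 1]. *)
Lemma double_3_thresholdP n (s : n.-tuple int) :
  reflect [/\ sorted (<%R)%R s, {subset s <= grid 1 (3 * n).+1} &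
    forall i, i < n -> ((3 * (1 + i))%N%:Z <= nth 0%R s i)%R]
  (double_3_threshold s).
Proof.
apply: (iffP andP) => [[s_lt /forallP s_bd]|[s_lt s_grid s_ge]]; split=> //.
- move=> x /tnthP [i ->]; have := s_bd i; move: (tnth s i) => y /andP [ge le].
  by rewrite mem_grid; apply/andP; split; lia.
- by move=> i ilt; have /andP [] := s_bd (Ordinal ilt); rewrite (tnth_nth 0%R).
apply/forallP => i; have := s_ge i (ltn_ord i).
have := s_grid _ (mem_tnth i s); rewrite mem_grid -tnth_nth.
move: (tnth s i) => y /andP [_ lt] ge.
by apply/andP; split; lia.
Qed.

Definition mark (n : nat) (s : seq int) : seq bool :=
  [seq x \in s | x <- grid 1 (3 * n).+1].

Definition unmark (n : nat) (w : seq bool) : seq int :=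
  mask w (grid 1 (3 * n).+1).

(** Two strictly increasing sequences with the same members are equal. *)
Lemma markK n (s : seq int) : sorted (<%R)%R s ->
  {subset s <= grid 1 (3 * n).+1} -> unmark n (mark n s) = s.
Proof.
move=> s_lt s_grid; rewrite /unmark /mark -filter_mask.
apply: lt_sorted_eq => //; first exact: lt_sorted_filter (sorted_grid _ _).
by move=> x; rewrite mem_filter andb_idr //; apply: s_grid.
Qed.

Lemma unmarkK n w : size w = (3 * n).+1 -> mark n (unmark n w) = w.
Proof.
move=> sw; apply: (@eq_from_nth _ false); rewrite /mark size_map size_grid //.
move=> i ilt; rewrite (nth_map 0%R) ?size_grid // in_mask ?uniq_grid //.
by rewrite mem_nth ?index_uniq ?size_grid ?uniq_grid.
Qed.

Lemma count_id_negb w : count id w + count negb w = size w.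
Proof. exact: (count_predC id). Qed.

Lemma size_unparse n p : internal_nodes p.1 + internal_nodes p.2 = n ->
  size (unparse p) = (3 * n).+1.
Proof.
move=> pn; have [h1 h2] := count_unparse p.
by rewrite -(count_id_negb (unparse p)); lia.
Qed.

Lemma threshold_runnable_mark n (s : n.-tuple int) : double_3_threshold s ->
  runnable 1 (mark n s) /\ count id (mark n s) = n.
Proof.
move=> /double_3_thresholdP [s_lt s_grid s_ge].
have sK := markK s_lt s_grid.
have sz : size (mark n s) = (3 * n).+1 by rewrite size_map size_grid.
(* The marks are as many as the terms they select, and these form [s] again. *)
have cnt : count id (mark n s) = n.
  by rewrite -[RHS](size_tuple s) -{2}sK size_mask ?sz ?size_grid.
(* The run starts with one leaf on the stack, before the first mark and at position 1. *)
split=> //; apply/(@runnable_maskP 1 1 1) => //.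
rewrite sz -/(unmark _ _) sK size_tuple; split=> //.
by have := count_id_negb (mark n s); lia.
Qed.

Lemma internal_nodes_parse_mark n (s : n.-tuple int) : double_3_threshold s ->
  internal_nodes (parse (mark n s)).1 + internal_nodes (parse (mark n s)).2 == n.
Proof.
move=> /threshold_runnable_mark [run cnt].
by have [<- _] := count_unparse (parse (mark n s)); rewrite parseK // cnt.
Qed.

Lemma size_unmark_unparse n p :
  internal_nodes p.1 + internal_nodes p.2 == n -> size (unmark n (unparse p)) == n.
Proof.
move=> /eqP pn; rewrite size_mask ?size_grid ?(size_unparse pn) //.
by have [-> _] := count_unparse p; rewrite pn.
Qed.

Lemma double_3_threshold_unparse n p
    (pn : internal_nodes p.1 + internal_nodes p.2 == n) :
  double_3_threshold (Tuple (size_unmark_unparse pn)).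
Proof.
have sz := size_unparse (eqP pn); apply/double_3_thresholdP; split=> /=.
- by apply: sorted_mask (sorted_grid _ _); exact: lt_trans.
- by move=> x /mem_mask.
have := runnable_unparse p; move/(@runnable_maskP 1 1 1 _ erefl) => [+ _].
by rewrite sz -/(unmark _ _) (eqP (size_unmark_unparse pn)).
Qed.

Theorem proposition2p3 (n : nat) (hn : 1 <= n) :
  exists f : {s : n.-tuple int | double_3_threshold s} ->
             {p : ternary_tree * ternary_tree |
               internal_nodes p.1 + internal_nodes p.2 == n},
    bijective f.
Proof.
pose f (s : {s : n.-tuple int | double_3_threshold s}) :
    {p | internal_nodes p.1 + internal_nodes p.2 == n} :=
  exist _ (parse (mark n (val s))) (internal_nodes_parse_mark (valP s)).
pose g (p : {p | internal_nodes p.1 + internal_nodes p.2 == n}) :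
    {s : n.-tuple int | double_3_threshold s} :=
  exist _ (Tuple (size_unmark_unparse (valP p)))
    (double_3_threshold_unparse (valP p)).
exists f; exists g => [[s hs]|[p hp]]; apply: val_inj => /=.
  apply: val_inj => /=; have [run _] := threshold_runnable_mark hs.
  by rewrite parseK //; apply: markK; case/double_3_thresholdP: hs.
by rewrite unmarkK ?unparseK //; exact: size_unparse (eqP hp).
Qed.
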